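(* Let $X_0\in\Gamma_1$ and let $(X_n)_{n\ge0}$ be the sequence produced by the iterative proportional fitting procedure started at $X_0$ with target marginals $a,b$. Assume that $\Gamma$ contains some matrix with the same support as $X_0$. Then: 1. For all $i\in\{1,\dots,p\}$ and $j\in\{1,\dots,q\}$, the sequences $(R_i(X_{2n}))_{n\ge0}$ and $(C_j(X_{2n+1}))_{n\ge0}$ converge to $1$ at an at least geometric rate. 2. The sequence $(X_n)_{n\ge0}$ converges to some matrix $X_\infty$ which has the same support as $X_0$. The rate of convergence is at least geometric. 3. The limit $X_\infty$ is the only matrix in $\Gamma\cap\Delta_pX_0\Delta_q$. It is also the unique matrix achieving the minimum of $D(Y\|X_0)$ over all $Y\in\Gamma(X_0)$.
   Context: Fix integers $p,q\ge 2$ and vectors $a=(a_1,\dots,a_p)$, $b=(b_1,\dots,b_q)$ with positive components such that $\sum_i a_i=\sum_j b_j=1$. For a $p\times q$ matrix $X$, set $X(i,+)=\sum_jX(i,j)$, $X(+,j)=\sum_iX(i,j)$, $X(+,+)=\sum_{i,j}X(i,j)$, $R_i(X)=X(i,+)/a_i$, $C_j(X)=X(+,j)/b_j$. $\Gamma_0$ is the set of non-negative $p\times q$ matrices all of whose row sums and column sums are positive; $\Gamma_1=\{X\in\Gamma_0:X(+,+)=1\}$; $\Gamma=\Gamma(a,b)$ is the set of $X\in\Gamma_0$ with $X(i,+)=a_i$ for all $i$ and $X(+,j)=b_j$ for all $j$. $\mathrm{Supp}(X)=\{(i,j):X(i,j)>0\}$ and $\Gamma(X_0)=\{S\in\Gamma:\mathrm{Supp}(S)\subset\mathrm{Supp}(X_0)\}$.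 $\Delta_m$ is the set of $m\times m$ diagonal matrices with positive diagonal entries, and $\Delta_pX_0\Delta_q=\{D_1X_0D_2:D_1\in\Delta_p,D_2\in\Delta_q\}$. Iterative proportional fitting procedure (IPFP): for $X\in\Gamma_0$ let $T_R(X)(i,j)=X(i,j)/R_i(X)$ and $T_C(X)(i,j)=X(i,j)/C_j(X)$; then $X_{2n+1}=T_R(X_{2n})$ and $X_{2n+2}=T_C(X_{2n+1})$ for all $n\ge0$. Relative entropy: for $X,Y\in\Gamma_1$, $D(Y\|X)=\sum_{(i,j)\in\mathrm{Supp}(X)}Y(i,j)\ln\frac{Y(i,j)}{X(i,j)}$ if $\mathrm{Supp}(Y)\subset\mathrm{Supp}(X)$ (with $0\ln0=0$), and $D(Y\|X)=+\infty$ otherwise. A sequence $(x_n)$ converging to $x_\infty$ in a normed space converges at an at least geometric rate if $\limsup_n\|x_n-x_\infty\|^{1/n}<1$. *)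

(* Defs.v *)
From HB Require Import structures.
From mathcomp Require Import all_boot all_order all_algebra.
From mathcomp Require Import all_classical all_reals all_analysis.

Set Implicit Arguments.
Unset Strict Implicit.
Unset Printing Implicit Defensive.

Import Order.TTheory GRing.Theory Num.Theory.
Import numFieldNormedType.Exports.

Local Open Scope classical_set_scope.
Local Open Scope ring_scope.

(* The term of index 0 has exponent 0^-1 = 0, hence value 1; it is irrelevant
   to the limsup. For n > 0, 0 `^ n%:R^-1 = 0 as expected. *)
Definition geometric_cvg (R : realType) (V : normedModType R)
    (x : nat -> V) (l : V) : Prop :=
  x @ \oo --> l /\
  (limn_esup (fun n => (`|x n - l| `^ n%:R^-1)%:E) < 1%:E)%E.

Section Matrices.
Context {R : realType} {p q : nat}.
Implicit Types (X Y S : 'M[R]_(p, q)) (a : 'rV[R]_p) (b : 'rV[R]_q).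

Definition row_sum X (i : 'I_p) : R := \sum_j X i j.
Definition col_sum X (j : 'I_q) : R := \sum_i X i j.
Definition total_sum X : R := \sum_i \sum_j X i j.

Definition row_ratio a X (i : 'I_p) : R := row_sum X i / a 0 i.
Definition col_ratio b X (j : 'I_q) : R := col_sum X j / b 0 j.

Definition Gamma0 : set 'M[R]_(p, q) :=
  [set X : 'M[R]_(p, q) |
    [/\ forall i j, 0 <= X i j,
        forall i, 0 < row_sum X i
      & forall j, 0 < col_sum X j]].

Definition Gamma1 : set 'M[R]_(p, q) :=
  [set X : 'M[R]_(p, q) | Gamma0 X /\ total_sum X = 1].

Definition Gamma a b : set 'M[R]_(p, q) :=
  [set X : 'M[R]_(p, q) |
    [/\ Gamma0 X,
        forall i, row_sum X i = a 0 i
      & forall j, col_sum X j = b 0 j]].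

Definition Supp X : {set 'I_p * 'I_q} :=
  [set ij : 'I_p * 'I_q | 0 < X ij.1 ij.2]%SET.

Definition Gamma_sub a b (X0 : 'M[R]_(p, q)) : set 'M[R]_(p, q) :=
  [set S : 'M[R]_(p, q) | Gamma a b S /\ (Supp S \subset Supp X0)].

Definition ipfp_row a X : 'M[R]_(p, q) :=
  \matrix_(i, j) (X i j / row_ratio a X i).
Definition ipfp_col b X : 'M[R]_(p, q) :=
  \matrix_(i, j) (X i j / col_ratio b X j).

Fixpoint ipfp a b (X0 : 'M[R]_(p, q)) (n : nat) : 'M[R]_(p, q) :=
  if n is m.+1 then
    if odd m then ipfp_col b (ipfp a b X0 m) else ipfp_row a (ipfp a b X0 m)
  else X0.

(* D(Y || X); the convention 0 ln 0 = 0 is automatic since ln is total. *)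
Definition rel_entropy Y X : \bar R :=
  if Supp Y \subset Supp X then
    (\sum_(ij in Supp X)
        Y ij.1 ij.2 * ln (Y ij.1 ij.2 / X ij.1 ij.2))%:E
  else +oo%E.

End Matrices.

Definition pos_diag (R : realType) (m : nat) : set 'M[R]_m :=
  [set D : 'M[R]_m | is_diag_mx D /\ forall i, 0 < D i i].

Definition diag_equiv (R : realType) (p q : nat) (X0 : 'M[R]_(p, q)) :
    set 'M[R]_(p, q) :=
  [set D1 *m X0 *m D2 | D1 in @pos_diag R p & D2 in @pos_diag R q].

(* Main.v *)
Require Import Defs.
From HB Require Import structures.
From mathcomp Require Import all_boot all_order all_algebra.
From mathcomp Require Import all_classical all_reals all_analysis.
From mathcomp Require Import ring lra.

(** Why the theorem holds.  Fix a matrix [S] of [Gamma a b] with the support of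
    [X0].  The procedure is alternating maximization of the log-likelihood
    [L X = \sum_(i, j) S i j * ln (X i j)] over the matrices
    [D1 X0 D2] of mass 1: from the second matrix on, one step divides the entries by
    [R_i * C_j], and changes [L] by [- \sum_i a_i ln R_i - \sum_j b_j ln C_j].  Two
    estimates, both relative to the sum [G X] of the squared errors of all marginals,
    give a linear rate:

    - the gain [L (X_(n+1)) - L (X_n)] is at least [G (X_n) / 4]
      ([log_likelihood_gain]), because each of the two sums is a relative entropy;
    - the potential gain is at most [C * G (X_n)]: no scaling [Y] of [X_n] of
      mass 1 whose entries on the support are at least [e] has
      [L Y - L (X_n) > C * G (X_n)] ([log_likelihood_error_bound]), because [L]
      is affine, and the total mass strongly convex, in the logarithms of the
      scaling factors.

    Since [L] is nondecreasing along the procedure and all entries are at most 1,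
    the entries on the support stay above some [e > 0] ([ipfp_lower_bound]), so the
    second estimate applies with [Y = X_m] for every [m > n].  Hence
    [L (X_m) - L (X_n) <= 4 C (L (X_(n+1)) - L (X_n))], and the distance from
    [L (X_n)] to its supremum decays geometrically
    ([geometric_of_self_bounding]); so do [G (X_n)], the deviations of the [R_i]
    and [C_j] from 1, and their logarithms.  The logarithms of the accumulated
    scaling factors are therefore geometrically convergent series, which yields
    the limit of [X_n] and at the same time its form [D1 X0 D2]
    ([ipfp_geometric_limit]).

    The last assertion is a Pythagorean inequality ([entropy_gap]): if [Y] is in
    [Gamma a b] and is a scaling of [X0], then [D (Z || X0) - D (Y || X0)] equals
    [D (Z || Y)] for each competitor [Z], which is at least a quarter of the squared
    distance from [Z] to [Y].  So any such [Y] is the unique minimizer, which leaves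
    room for only one such [Y]. *)

Import Order.TTheory GRing.Theory Num.Theory.
Import numFieldNormedType.Exports.

Set Implicit Arguments.
Unset Strict Implicit.

Local Open Scope classical_set_scope.
Local Open Scope ring_scope.

(** * Elementary inequalities *)

Section RealInequalities.
Context {R : realType}.
Implicit Types x y : R.

Lemma ln_le_subr1 x : 0 < x -> ln x <= x - 1.
Proof. by move=> x0; rewrite -[in ln x](subrKC 1 x) le_ln1Dx//; lra. Qed.

(** A summand of the relative entropy, corrected by [y - x] so as to be nonnegative,
    controls the square of [x - y].  Applying [ln z <= z - 1] to
    [z = sqrt (y / x)] instead of [y / x] leaves [(sqrt x - sqrt y) ^+ 2].  This one
    inequality is used for the gain, for the strong convexity of the mass and for
    uniqueness. *)
Lemma kl_term_ge x y : 0 <= x <= 1 -> 0 < y <= 1 ->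
  (x - y) ^+ 2 / 4 <= x * ln (x / y) - x + y.
Proof.
move=> /andP[x0 x1] /andP[y0 y1].
have [->|xn0] := eqVneq x 0.
  rewrite mul0r !sub0r sqrrN oppr0 add0r.
  have : y * y <= y * 1 by rewrite ler_pM2l.
  by rewrite expr2; lra.
have {xn0}x0 : 0 < x by rewrite lt_neqAle eq_sym xn0.
set s := Num.sqrt x; set t := Num.sqrt y.
have s0 : 0 < s by rewrite sqrtr_gt0.
have t0 : 0 < t by rewrite sqrtr_gt0.
have sx : s ^+ 2 = x by rewrite sqr_sqrtr// ltW.
have ty : t ^+ 2 = y by rewrite sqr_sqrtr// ltW.
have s1 : s <= 1 by rewrite -sqrtr1 ler_sqrt.
have t1 : t <= 1 by rewrite -sqrtr1 ler_sqrt.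
have -> : ln (x / y) = - 2 * ln (t / s).
  rewrite -sx -ty !ln_div ?posrE ?exprn_gt0// !lnXn//; ring.
have h : ln (t / s) <= t / s - 1 by apply: ln_le_subr1; rewrite divr_gt0.
have : s ^+ 2 * (- 2 * (t / s - 1)) <= x * (- 2 * ln (t / s)).
  by rewrite sx ler_pM2l//; lra.
have -> : s ^+ 2 * (- 2 * (t / s - 1)) = 2 * s ^+ 2 - 2 * s * t.
  by field; rewrite gt_eqF.
have : (s ^+ 2 - t ^+ 2) ^+ 2 <= 4 * (s - t) ^+ 2.
  rewrite subr_sqr exprMn mulrC ler_wpM2r ?sqr_ge0//.
  have : (s + t) ^+ 2 <= 2 ^+ 2 by rewrite lerXn2r ?nnegrE; lra.
  by rewrite expr2; lra.
rewrite -sx -ty; nra.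
Qed.

Lemma dist_ln_le e x y : 0 < e -> e <= x -> e <= y ->
  `|ln x - ln y| <= `|x - y| / e.
Proof.
move=> e0.
wlog xy : x y / y <= x => [hw ex ey|ex ey].
  have /orP[yx|xy] := le_total y x; first exact: hw.
  by rewrite distrC (distrC x); apply: hw.
have x0 : 0 < x by lra. have y0 : 0 < y by lra.
rewrite !ger0_norm ?subr_ge0// ?ler_ln ?posrE//.
rewrite -ln_div ?posrE//; apply: (le_trans (ln_le_subr1 _)).
  exact: divr_gt0.
have -> : x / y - 1 = (x - y) / y by field; rewrite gt_eqF.
by rewrite ler_wpM2l ?subr_ge0// lef_pV2 ?posrE.
Qed.

Lemma dist_expR_le x y : x <= 0 -> y <= 0 ->
  `|expR x - expR y| <= `|x - y|.
Proof.
wlog xy : x y / y <= x => [hw ex ey|x0 _].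
  have /orP[yx|xy] := le_total y x; first exact: hw.
  by rewrite distrC (distrC x); apply: hw.
rewrite !ger0_norm ?subr_ge0// ?ler_expR//.
have -> : expR x - expR y = expR x * (1 - expR (y - x)).
  by rewrite mulrBr mulr1 -expRD subrKC.
apply: (@le_trans _ _ (1 - expR (y - x))).
  rewrite ler_piMl// ?expR_le1// subr_ge0 expR_le1; lra.
by have := expR_ge1Dx (y - x); lra.
Qed.

End RealInequalities.

(** * Geometric rates of convergence *)

Section Sequences.
Context {R : realType}.
Implicit Types (x : nat -> R) (K t l : R).

Lemma near_geometric_le K t s : 0 < t < s -> \forall n \near \oo, K * t ^+ n <= s ^+ n.
Proof.
move=> /andP[t0 ts]; have s0 : 0 < s by lra.
have /cvgrPdist_le/(_ 1 ltr01) : (fun n => K * (t / s) ^+ n) @ \oo --> 0.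
  apply: cvg_geometric; rewrite ger0_norm ?divr_ge0 ?ltW//.
  by rewrite ltr_pdivrMr ?mul1r.
apply: filterS => n; rewrite sub0r normrN => /ler_normlW.
by rewrite expr_div_n mulrA ler_pdivrMr ?exprn_gt0// mul1r.
Qed.

(** The constant [K] disappears from the limsup of the roots: for any [s] strictly
    between [t] and 1, [K * t ^+ n] is eventually below [s ^+ n]. *)
Lemma geometric_cvg_of_le (V : normedModType R) (x : nat -> V) (l : V) K t :
  0 < t < 1 -> (forall n, (0 < n)%N -> `|x n - l| <= K * t ^+ n) ->
  geometric_cvg x l.
Proof.
move=> /andP[t0 t1] xl; split.
  apply/cvgrPdist_le => e e0.
  have /cvgrPdist_le/(_ e e0) : (fun n => K * t ^+ n) @ \oo --> 0.
    by apply: cvg_geometric; rewrite ger0_norm ?ltW.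
  move=> h; near=> n; rewrite distrC.
  apply: (le_trans (xl n _)); first by near: n; exact: nbhs_infty_gt.
  apply: le_trans (ler_norm _) _; rewrite -normrN -sub0r; near: n; exact: h.
set s := (t + 1) / 2.
have ts : 0 < t < s by rewrite /s; apply/andP; split; lra.
have s0 : 0 < s by rewrite /s; lra.
apply: (@le_lt_trans _ _ s%:E); last by rewrite lte_fin /s; lra.
have [N _ hN] := near_geometric_le K ts.
apply: ge_ereal_inf; exists (ereal_sup
    ((fun n : nat => (`|x n - l| `^ n%:R^-1)%:E) @` [set n | (N.+1 <= n)%N])).
  by exists [set n | (N.+1 <= n)%N] => //; exists N.+1.
apply: ge_ereal_sup => _ [n /= Nn <-]; rewrite lee_fin.
have n0 : (0 < n)%N by exact: leq_ltn_trans Nn.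
have -> : s = (s ^+ n) `^ n%:R^-1.
  by rewrite -powR_mulrn ?ltW// -powRrM divff ?powRr1 ?ltW// pnatr_eq0 -lt0n.
apply: ge0_ler_powR; rewrite ?nnegrE ?exprn_ge0 ?invr_ge0 ?(ltW s0)//.
by apply: (le_trans (xl n n0)); apply: hN; exact: ltnW.
Unshelve. all: by end_near. Qed.

(** If the whole future increase of [x] is at most [D] times its next increment,
    then the distance [E n] to the supremum satisfies [E n <= D * (E n - E n.+1)],
    a contraction by the factor [1 - 1 / D] once [D] is taken larger than 1. *)
Lemma geometric_of_self_bounding x D : nondecreasing_seq x ->
  (exists M, forall n, x n <= M) ->
  (forall n m, (n <= m)%N -> x m - x n <= D * (x n.+1 - x n)) ->
  exists K t, [/\ 0 <= K, 0 < t < 1 & forall n, x n.+1 - x n <= K * t ^+ n].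
Proof.
move=> ndx [M xM] hD.
pose C := `|D| + 1; have C1 : 1 <= C by rewrite /C lerDr.
pose l := sup (range x).
have xl n : x n <= l.
  by apply: ub_le_sup; [exists M => _ [m _ <-] | exists n].
have lx n : l - x n <= C * (x n.+1 - x n).
  rewrite lerBlDr; apply: ge_sup; first by exists (x 0%N); exists 0%N.
  move=> _ [m _ <-].
  have d0 : 0 <= x n.+1 - x n by rewrite subr_ge0 ndx.
  rewrite -lerBlDr; have [nm|mn] := leqP n m.
    apply: (le_trans (hD n m nm)); rewrite ler_wpM2r// /C.
    by have := ler_norm D; lra.
  have xmn := ndx _ _ (ltnW mn).
  by apply: (@le_trans _ _ 0); [lra | rewrite mulr_ge0//; lra].
(* the ratio 1 - 1 / C would vanish for C = 1, and t must be positive *)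
pose t := 1 - (C + 1)^-1.
have Ci : 0 < (C + 1)^-1 by rewrite invr_gt0; lra.
have Ci1 : (C + 1)^-1 < 1 by rewrite invf_lt1; lra.
have t0 : 0 < t by rewrite /t; lra.
have E n : l - x n <= (l - x 0%N) * t ^+ n.
  elim: n => [|n ih]; first by rewrite expr0 mulr1.
  apply: (@le_trans _ _ ((l - x n) * t)); last first.
    by rewrite exprSr mulrA ler_pM2r.
  have h1 := lx n; have h2 := xl n; have h3 := xl n.+1.
  have d0 : 0 <= x n.+1 - x n by rewrite subr_ge0 ndx.
  have : (l - x n) / (C + 1) <= x n.+1 - x n.
    rewrite ler_pdivrMr; last lra.
    by rewrite mulrC; lra.
  rewrite /t; lra.
exists (l - x 0%N), t; split.
- by rewrite subr_ge0.
- by rewrite t0 /t; lra.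
- by move=> n; apply: le_trans (E n); have := xl n.+1; lra.
Qed.

End Sequences.

Section GeometricBounds.
Context {R : realType} (t : R) (t01 : 0 < t < 1).
Implicit Types (x y : nat -> R) (l : R).

Definition geometric_to x l := exists K, forall n, `|x n - l| <= K * t ^+ n.

Lemma geometric_to_le x y l l' c : geometric_to x l ->
  (forall n, `|y n - l'| <= c * `|x n - l|) -> geometric_to y l'.
Proof.
move=> [K hK] hy; exists (`|c| * K) => n.
apply: (le_trans (hy n)); rewrite -mulrA.
apply: (@le_trans _ _ (`|c| * `|x n - l|)).
  by rewrite ler_wpM2r// ler_norm.
by rewrite ler_wpM2l.
Qed.

Lemma geometric_toD x y l l' : geometric_to x l -> geometric_to y l' ->
  geometric_to (fun n => x n + y n) (l + l').
Proof.
move=> [K hK] [K' hK']; exists (K + K') => n.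
have -> : x n + y n - (l + l') = (x n - l) + (y n - l') by ring.
by rewrite (le_trans (ler_normD _ _))// mulrDl lerD.
Qed.

Lemma geometric_to_cst l : geometric_to (fun=> l) l.
Proof. by exists 0 => n; rewrite subrr normr0 mul0r. Qed.

Lemma geometric_to_sum (I : finType) (f : I -> nat -> R) (l : I -> R) :
  (forall i, geometric_to (f i) (l i)) ->
  geometric_to (fun n => \sum_i f i n) (\sum_i l i).
Proof.
move=> hf; suff [K hK] : exists K, forall n,
    `|\sum_(i <- index_enum I) f i n - \sum_(i <- index_enum I) l i| <= K * t ^+ n.
  by exists K.
elim: (index_enum I) => [|i s [K hK]].
  by exists 0 => n; rewrite !big_nil subrr normr0 mul0r.
have [K' hK'] : geometric_to (fun n => f i n + \sum_(i <- s) f i n)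
    (l i + \sum_(i <- s) l i).
  by apply: geometric_toD; [exact: hf | exists K].
by exists K' => n; rewrite !big_cons.
Qed.

Lemma geometric_to_cvg x l : geometric_to x l -> x @ \oo --> l.
Proof.
move=> [K hK].
by have [] := @geometric_cvg_of_le R R^o x l K t t01 (fun n _ => hK n).
Qed.

Lemma geometric_to_unique x l l' : geometric_to x l -> geometric_to x l' -> l = l'.
Proof.
move=> /geometric_to_cvg h /geometric_to_cvg h'.
exact: (cvg_unique _ h h').
Qed.

Lemma geometric_to_ub x l c : geometric_to x l -> (forall n, x n <= c) -> l <= c.
Proof. by move=> /geometric_to_cvg h xc; apply: (cvgr_to_le h); exact: nearW. Qed.

(** The tail [r n = K / (1 - t) * t ^+ n] of the geometric series makes
    [x n - r n] nondecreasing and [x n + r n] nonincreasing, so that the intervals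
    between them are nested; the supremum of the lower ends is the limit. *)
Lemma geometric_cauchy x K :
  (forall n, `|x n.+1 - x n| <= K * t ^+ n) ->
  exists l, geometric_to x l.
Proof.
move=> hx; have /andP[t0 t1] := t01.
pose r n := K / (1 - t) * t ^+ n.
have rS n : r n - r n.+1 = K * t ^+ n.
  by rewrite /r exprS; field; lra.
have h n m : `|x (n + m)%N - x n| <= r n - r (n + m)%N.
  elim: m => [|m ih]; first by rewrite addn0 !subrr normr0.
  rewrite addnS.
  have -> : x (n + m).+1 - x n = (x (n + m).+1 - x (n + m)%N) + (x (n + m)%N - x n).
    by rewrite addrA subrK.
  apply: (le_trans (ler_normD _ _)).
  have := hx (n + m)%N; rewrite -rS; lra.
have K0 : 0 <= K by have := le_trans (normr_ge0 _) (hx 0%N); rewrite expr0 mulr1.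
have r0 n : 0 <= r n.
  by apply: mulr_ge0; [apply: divr_ge0 => //; lra | rewrite exprn_ge0// ltW].
have h' n m : x m - r m <= x n + r n.
  have /orP[/subnK|/subnK] := leq_total n m => e.
    have := h n (m - n)%N; rewrite addnC e => /ler_normlW.
    by have := r0 m; lra.
  have := h m (n - m)%N; rewrite addnC e distrC => /ler_normlW.
  by have := r0 n; lra.
pose E := [set x m - r m | m in [set: nat]].
exists (sup E), (K / (1 - t)) => n; rewrite ler_distl; apply/andP; split.
  suff : sup E <= x n + r n by rewrite -/(r n); lra.
  apply: ge_sup; first by exists (x 0%N - r 0%N); exists 0%N.
  by move=> _ [m _ <-].
suff : x n - r n <= sup E by rewrite -/(r n); lra.
apply: ub_le_sup; last by exists n.
by exists (x 0%N + r 0%N) => _ [m _ <-].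
Qed.

End GeometricBounds.

(** * Scaling factors controlled by their effect on the entries *)

Section BoundedPreimage.
Context {R : rcfType}.

(** The pseudo-inverse selects a preimage depending linearly on the image, hence
    bounded by it, even when [M] has a kernel. *)
Lemma mulmx_bounded_preimage m n (M : 'M[R]_(m, n)) :
  exists2 K : R, 0 < K & forall x : 'rV_m, exists2 x' : 'rV_m,
    x' *m M = x *m M &
    \sum_i x' 0 i ^+ 2 <= K * \sum_j (x *m M) 0 j ^+ 2.
Proof.
pose N := \sum_i \sum_j `|pinvmx M j i|.
have N0 : 0 <= N by apply: sumr_ge0 => i _; apply: sumr_ge0.
exists (m%:R * N ^+ 2 + 1); first by rewrite ltr_wpDl// mulr_ge0// exprn_ge0.
move=> x; exists (x *m M *m pinvmx M).
  by apply: mulmxKpV; exact: submxMl.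
move: (x *m M) => w {x}.
set W := \sum_j w 0 j ^+ 2.
have W0 : 0 <= W by apply: sumr_ge0 => j _; exact: sqr_ge0.
have wW j : `|w 0 j| <= Num.sqrt W.
  rewrite -sqrtr_sqr ler_sqrt// /W (bigD1 j)//= lerDl.
  by apply: sumr_ge0 => k _; exact: sqr_ge0.
have hi i : (w *m pinvmx M) 0 i ^+ 2 <= N ^+ 2 * W.
  rewrite -[W]sqr_sqrtr// -exprMn -real_normK ?num_real//.
  rewrite lerXn2r ?nnegrE ?mulr_ge0 ?sqrtr_ge0//.
  rewrite mxE (le_trans (ler_norm_sum _ _ _))//.
  rewrite /N (bigD1 i)//= mulrDl -[leLHS]addr0 lerD//.
    rewrite mulr_suml ler_sum// => j _.
    by rewrite normrM mulrC ler_wpM2l.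
  by rewrite mulr_ge0 ?sqrtr_ge0//; do 2!apply: sumr_ge0 => ? _.
apply: (@le_trans _ _ (\sum_(i < m) N ^+ 2 * W)); first exact: ler_sum.
rewrite sumr_const card_ord -[leLHS]mulr_natl; nra.
Qed.

(** The potentials [u], [v] are not determined by the sums [u i + v j] over [A]
    (constants may move from [u] to [v] on each connected component of the bipartite
    graph [A]), so they can be large while all these sums are small; other
    potentials with the same sums are not. *)
Lemma balanced_potentials p q (A : 'I_p -> 'I_q -> bool) :
  exists2 K : R, 0 < K & forall (u : 'I_p -> R) (v : 'I_q -> R),
    exists u' v',
      (forall i j, A i j -> u' i + v' j = u i + v j) /\
      \sum_i u' i ^+ 2 + \sum_j v' j ^+ 2 <=
        K * \sum_i \sum_j (if A i j then (u i + v j) ^+ 2 else 0).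
Proof.
(* the map from (u, v) to the family of sums over A, as a matrix *)
pose e (k : 'I_#|{: 'I_p * 'I_q}|) := enum_val k.
pose M1 : 'M[R]_(p, _) := \matrix_(i, k) (A (e k).1 (e k).2 && ((e k).1 == i))%:R.
pose M2 : 'M[R]_(q, _) := \matrix_(j, k) (A (e k).1 (e k).2 && ((e k).2 == j))%:R.
have Mk (x : 'rV_(p + q)) k : (x *m col_mx M1 M2) 0 k =
    if A (e k).1 (e k).2 then lsubmx x 0 (e k).1 + rsubmx x 0 (e k).2 else 0.
  rewrite -{1}[x]hsubmxK mul_row_col !mxE.
  case: ifP => Ak; last first.
    rewrite !big1 ?addr0// => i _; rewrite !mxE Ak mulr0//.
  rewrite (bigD1 (e k).1)//= [X in _ + X](bigD1 (e k).2)//= !mxE Ak !eqxx !mulr1.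
  rewrite !big1 ?addr0// => i /negPf ne; rewrite !mxE Ak /= eq_sym ne mulr0//.
have [K K0 hK] := mulmx_bounded_preimage (col_mx M1 M2).
exists K => // u v.
have [x xE hx] := hK (row_mx (\row_i u i) (\row_j v j)).
exists (lsubmx x 0), (rsubmx x 0); split => [i j Aij|].
  have := congr1 (fun z : 'rV_ _ => z 0 (enum_rank (i, j))) xE.
  by rewrite !Mk /e enum_rankK /= Aij row_mxKl row_mxKr !mxE.
move: hx; rewrite big_split_ord /=.
have -> : \sum_i x 0 (lshift q i) ^+ 2 = \sum_i lsubmx x 0 i ^+ 2.
  by apply: eq_bigr => i _; rewrite mxE.
have -> : \sum_i x 0 (rshift p i) ^+ 2 = \sum_i rsubmx x 0 i ^+ 2.
  by apply: eq_bigr => i _; rewrite mxE.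
move=> /le_trans; apply.
rewrite ler_pM2l// pair_bigA /= (reindex e) /=; last exact/onW_bij/enum_val_bij.
apply: ler_sum => k _; rewrite Mk row_mxKl row_mxKr !mxE.
by case: ifP; rewrite // expr0n.
Qed.

End BoundedPreimage.

(** * Diagonal scalings *)

Section Scaling.
Context {R : realType} {p q : nat}.
Implicit Types (X Y Z S : 'M[R]_(p, q)) (u : 'I_p -> R) (v : 'I_q -> R).

(** The relation between [X] and [Y] of [diag_equiv], written with the logarithms of the
    scaling factors, in which the log-likelihood is affine. *)
Definition scaling X Y :=
  exists u v, forall i j, Y i j = X i j * expR (u i + v j).

Lemma scaling_refl X : scaling X X.
Proof. by exists (fun=> 0), (fun=> 0) => i j; rewrite addr0 expR0 mulr1. Qed.

Lemma scaling_sym X Y : scaling X Y -> scaling Y X.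
Proof.
move=> [u [v h]]; exists (fun i => - u i), (fun j => - v j) => i j.
by rewrite h -mulrA -expRD -opprD subrr expR0 mulr1.
Qed.

Lemma scaling_trans X Y Z : scaling X Y -> scaling Y Z -> scaling X Z.
Proof.
move=> [u [v h]] [u' [v' h']].
exists (fun i => u i + u' i), (fun j => v j + v' j) => i j.
by rewrite h' h -mulrA -expRD; congr (_ * expR _); ring.
Qed.

Lemma scaling_gt0 X Y i j : scaling X Y -> (0 < Y i j) = (0 < X i j).
Proof. by move=> [u [v ->]]; rewrite pmulr_lgt0 ?expR_gt0. Qed.

Lemma scaling_Supp X Y : scaling X Y -> Supp Y = Supp X.
Proof. by move=> XY; apply/setP => ij; rewrite !inE (scaling_gt0 _ _ XY). Qed.

Lemma scaling_Gamma0 X Y : scaling X Y -> Gamma0 X -> Gamma0 Y.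
Proof.
move=> [u [v h]] [X0 Xr Xc]; split=> [i j|i|j].
- by rewrite h mulr_ge0// expR_ge0.
- rewrite lt_neqAle eq_sym andbC sumr_ge0/= => [|j _]; last first.
    by rewrite h mulr_ge0// expR_ge0.
  have := Xr i; apply: contraTneq => /psumr_eq0P Y0.
  rewrite /row_sum big1 ?ltxx// => j _; apply/eqP.
  have /eqP : Y i j = 0 by apply: Y0 => // k _; rewrite h mulr_ge0// expR_ge0.
  by rewrite h mulf_eq0 expR_eq0 orbF.
- rewrite lt_neqAle eq_sym andbC sumr_ge0/= => [|i _]; last first.
    by rewrite h mulr_ge0// expR_ge0.
  have := Xc j; apply: contraTneq => /psumr_eq0P Y0.
  rewrite /col_sum big1 ?ltxx// => i _; apply/eqP.
  have /eqP : Y i j = 0 by apply: Y0 => // k _; rewrite h mulr_ge0// expR_ge0.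
  by rewrite h mulf_eq0 expR_eq0 orbF.
Qed.

Lemma diag_equivP X Y : diag_equiv X Y <-> scaling X Y.
Proof.
split=> [[D1 [/diag_mxP[d1 ->] d1_gt0] [D2 [/diag_mxP[d2 ->] d2_gt0] <-]]|[u [v h]]].
  exists (fun i => ln (d1 0 i)), (fun j => ln (d2 0 j)) => i j.
  have h1 : 0 < d1 0 i by have := d1_gt0 i; rewrite mxE eqxx.
  have h2 : 0 < d2 0 j by have := d2_gt0 j; rewrite mxE eqxx.
  rewrite expRD !lnK ?posrE// mul_diag_mx mul_mx_diag !mxE; ring.
exists (diag_mx (\row_i expR (u i))).
  by split=> [|i]; rewrite ?diag_mx_is_diag// !mxE eqxx expR_gt0.
exists (diag_mx (\row_j expR (v j))).
  by split=> [|i]; rewrite ?diag_mx_is_diag// !mxE eqxx expR_gt0.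
by apply/matrixP => i j; rewrite mul_diag_mx mul_mx_diag !mxE h expRD; ring.
Qed.

Lemma total_sum_row X : total_sum X = \sum_i row_sum X i.
Proof. by []. Qed.

Lemma total_sum_col X : total_sum X = \sum_j col_sum X j.
Proof. exact: exchange_big. Qed.

Lemma Gamma1_le1 X i j : Gamma1 X -> X i j <= 1.
Proof.
move=> [[X0 _ _] <-]; rewrite /total_sum (bigD1 i)//= (bigD1 j)//=.
rewrite -addrA lerDl addr_ge0//; first exact: sumr_ge0.
by do 2!apply: sumr_ge0 => ? _.
Qed.

(** A matrix acts on the sums [u i + v j] through its marginals only, so that all
    elements of [Gamma a b] give the same value. *)
Lemma scaling_marginals X u v :
  \sum_i \sum_j X i j * (u i + v j) =
  \sum_i row_sum X i * u i + \sum_j col_sum X j * v j.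
Proof.
under eq_bigr do (under eq_bigr do rewrite mulrDr; rewrite big_split /=).
rewrite big_split /= [X in _ + X]exchange_big /=.
by congr (_ + _); apply: eq_bigr => i _; rewrite -mulr_suml.
Qed.

End Scaling.

(** * The fitting steps *)

Section IPFP.
Context {R : realType} {p q : nat} (a : 'rV[R]_p) (b : 'rV[R]_q).
Context (a_gt0 : forall i, 0 < a 0 i) (b_gt0 : forall j, 0 < b 0 j).
Context (a_sum : \sum_i a 0 i = 1) (b_sum : \sum_j b 0 j = 1).
Implicit Types (X Y Z S : 'M[R]_(p, q)).

Lemma Gamma_Gamma1 X : Gamma a b X -> Gamma1 X.
Proof.
move=> [X0 Xa _]; split=> //; rewrite total_sum_row -a_sum.
by apply: eq_bigr => i _; exact: Xa.
Qed.

Lemma row_ratio_gt0 X i : Gamma0 X -> 0 < row_ratio a X i.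
Proof. by case=> _ h _; apply: divr_gt0. Qed.

Lemma col_ratio_gt0 X j : Gamma0 X -> 0 < col_ratio b X j.
Proof. by case=> _ _ h; apply: divr_gt0. Qed.

Lemma row_sum_ipfp_row X i : Gamma0 X -> row_sum (ipfp_row a X) i = a 0 i.
Proof.
case=> _ h _; rewrite /row_sum; under eq_bigr do rewrite mxE.
rewrite -mulr_suml -/(row_sum X i) /row_ratio.
by field; rewrite !gt_eqF.
Qed.

Lemma col_sum_ipfp_col X j : Gamma0 X -> col_sum (ipfp_col b X) j = b 0 j.
Proof.
case=> _ _ h; rewrite /col_sum; under eq_bigr do rewrite mxE.
rewrite -mulr_suml -/(col_sum X j) /col_ratio.
by field; rewrite !gt_eqF.
Qed.

Lemma scaling_ipfp_row X : Gamma0 X -> scaling X (ipfp_row a X).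
Proof.
move=> X0; exists (fun i => - ln (row_ratio a X i)), (fun=> 0) => i j.
by rewrite mxE addr0 expRN lnK// posrE row_ratio_gt0.
Qed.

Lemma scaling_ipfp_col X : Gamma0 X -> scaling X (ipfp_col b X).
Proof.
move=> X0; exists (fun=> 0), (fun j => - ln (col_ratio b X j)) => i j.
by rewrite mxE add0r expRN lnK// posrE col_ratio_gt0.
Qed.

Lemma ipfp_scaling_Gamma1 X n : Gamma1 X ->
  scaling X (ipfp a b X n) /\ Gamma1 (ipfp a b X n).
Proof.
move=> X1; elim: n => [|n [sc [g0 _]]] /=; first by split=> //; exact: scaling_refl.
case: ifP => _.
  have sc' := scaling_ipfp_col g0.
  split; first exact: scaling_trans sc sc'.
  split; first exact: scaling_Gamma0 sc' g0.
  by rewrite total_sum_col -b_sum; apply: eq_bigr => j _; exact: col_sum_ipfp_col.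
have sc' := scaling_ipfp_row g0.
split; first exact: scaling_trans sc sc'.
split; first exact: scaling_Gamma0 sc' g0.
by rewrite total_sum_row -a_sum; apply: eq_bigr => i _; exact: row_sum_ipfp_row.
Qed.

(** From index 1 on, one family of marginals is already fitted and its ratios are 1,
    so a step may be written symmetrically as a division by all the ratios; the
    sequel needs no distinction between even and odd steps. *)
Lemma ipfp_two_sided_step X n : Gamma1 X ->
  forall i j, ipfp a b X n.+2 i j = ipfp a b X n.+1 i j /
    (row_ratio a (ipfp a b X n.+1) i * col_ratio b (ipfp a b X n.+1) j).
Proof.
move=> X1 i j.
have [_ [g0 _]] := ipfp_scaling_Gamma1 n X1.
have -> : ipfp a b X n.+2 = if odd n then ipfp_row a (ipfp a b X n.+1)
    else ipfp_col b (ipfp a b X n.+1) by rewrite /= if_neg.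
have [on|/negPf on] := boolP (odd n).
  have -> : col_ratio b (ipfp a b X n.+1) j = 1.
    by rewrite /= on /col_ratio col_sum_ipfp_col// divff// gt_eqF.
  by rewrite mulr1 mxE.
have -> : row_ratio a (ipfp a b X n.+1) i = 1.
  by rewrite /= on /row_ratio row_sum_ipfp_row// divff// gt_eqF.
by rewrite mul1r mxE.
Qed.

End IPFP.

(** * Gain of a step and error bound *)

Section LogLikelihood.
Context {R : realType} {p q : nat} (a : 'rV[R]_p) (b : 'rV[R]_q).
Context (a_gt0 : forall i, 0 < a 0 i) (b_gt0 : forall j, 0 < b 0 j).
Context (a_sum : \sum_i a 0 i = 1) (b_sum : \sum_j b 0 j = 1).
Implicit Types (X Y Z S : 'M[R]_(p, q)).

Definition log_likelihood S X := \sum_i \sum_j S i j * ln (X i j).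

Definition marginal_gap X :=
  \sum_i (a 0 i - row_sum X i) ^+ 2 + \sum_j (b 0 j - col_sum X j) ^+ 2.

Lemma marginal_gap_ge0 X : 0 <= marginal_gap X.
Proof. by apply: addr_ge0; apply: sumr_ge0 => ? _; exact: sqr_ge0. Qed.

Lemma log_likelihood_le0 S X : Gamma0 S -> Gamma1 X -> log_likelihood S X <= 0.
Proof.
move=> [S0 _ _] X1; apply: sumr_le0 => i _; apply: sumr_le0 => j _.
by rewrite mulr_ge0_le0// ln_le0// Gamma1_le1.
Qed.

Lemma log_likelihood_diff S X Y u v : Gamma a b S ->
  (forall i j, 0 < S i j -> 0 < X i j) ->
  (forall i j, Y i j = X i j * expR (u i + v j)) ->
  log_likelihood S Y - log_likelihood S X =
    \sum_i a 0 i * u i + \sum_j b 0 j * v j.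
Proof.
move=> [[S0 _ _] Sa Sb] SX YE.
under [X in _ = X + _]eq_bigr do rewrite -Sa.
under [X in _ = _ + X]eq_bigr do rewrite -Sb.
rewrite -scaling_marginals -sumrB; apply: eq_bigr => i _.
rewrite -sumrB; apply: eq_bigr => j _; rewrite -mulrBr.
have := S0 i j; rewrite le_eqVlt => /predU1P[<-|Sij]; first by rewrite !mul0r.
have Xij := SX i j Sij.
by rewrite YE lnM ?posrE ?expR_gt0// expRK addrAC subrr add0r.
Qed.

(** The change of the log-likelihood is the sum of the relative entropies of [a] with
    respect to the row sums and of [b] with respect to the column sums. *)
Lemma log_likelihood_gain S X Y : Gamma a b S -> Gamma1 X ->
  (forall i j, 0 < S i j -> 0 < X i j) ->
  (forall i j, Y i j = X i j / (row_ratio a X i * col_ratio b X j)) ->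
  marginal_gap X / 4 <= log_likelihood S Y - log_likelihood S X.
Proof.
move=> SG [X0 X1] SX YE.
have le1 m (c : 'rV[R]_m) : (forall i, 0 < c 0 i) -> \sum_i c 0 i = 1 ->
    forall i, 0 < c 0 i <= 1.
  move=> c0 c1 i; rewrite c0/= -c1 (bigD1 i)//= lerDl.
  by apply: sumr_ge0 => k _; exact: ltW.
have gain m (c r : 'I_m -> R) : (forall i, 0 < c i <= 1) -> (forall i, 0 < r i <= 1) ->
    \sum_i c i = 1 -> \sum_i r i = 1 ->
    (\sum_i (c i - r i) ^+ 2) / 4 <= \sum_i c i * - ln (r i / c i).
  move=> c01 r01 c1 r1.
  have -> : \sum_i c i * - ln (r i / c i) =
      \sum_i (c i * - ln (r i / c i) + (r i - c i)).
    by rewrite big_split/= sumrB c1 r1 subrr addr0.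
  rewrite mulr_suml.
  apply: ler_sum => i _.
  have /andP[c0 c1'] := c01 i; have /andP[r0 _] := r01 i.
  have := @kl_term_ge R (c i) (r i); rewrite (ltW c0) c1' r01 => /(_ isT isT).
  by rewrite !ln_div ?posrE//; lra.
rewrite (@log_likelihood_diff S X Y (fun i => - ln (row_ratio a X i))
  (fun j => - ln (col_ratio b X j)))//; last first.
  move=> i j; rewrite YE expRD !expRN !lnK ?posrE ?row_ratio_gt0 ?col_ratio_gt0//.
  by rewrite invfM.
have [Xge Xr Xc] := X0.
rewrite /marginal_gap mulrDl lerD//; apply: gain => //; try exact: le1.
  move=> i; rewrite Xr/= -X1 total_sum_row (bigD1 i)//= lerDl.
  by apply: sumr_ge0 => k _; exact: ltW.
move=> j; rewrite Xc/= -X1 total_sum_col (bigD1 j)//= lerDl.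
by apply: sumr_ge0 => k _; exact: ltW.
by rewrite -total_sum_col.
Qed.

(** With [w = ln Y - ln X = u i + v j], [kl_term_ge] gives
    [Y - X >= X * w + (e ^+ 2 / 4) * w ^+ 2] on the support.  Summing, and using
    that the total masses agree, [\sum S * w] is at most
    [\sum (S - X) * w - (e ^+ 2 / 4) * \sum w ^+ 2].  The first term pairs the
    marginal errors of [X] with any potentials representing [w]; for balanced
    ones, Young's inequality absorbs them into the quadratic term. *)
Lemma log_likelihood_error_bound S e : Gamma a b S -> 0 < e ->
  exists2 C, 0 < C & forall X Y, Gamma1 X -> Gamma1 Y ->
    (forall i j, (0 < X i j) = (0 < S i j)) ->
    (forall i j, 0 < S i j -> e <= X i j) ->
    (forall i j, 0 < S i j -> e <= Y i j) ->
    scaling X Y ->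
    log_likelihood S Y - log_likelihood S X <= C * marginal_gap X.
Proof.
move=> SG e0.
have [K K0 hK] := @balanced_potentials R p q (fun i j => 0 < S i j).
(* the weight in Young's inequality for which m * K is the constant e ^+ 2 / 4 *)
pose m := e ^+ 2 / (4 * K).
have m0 : 0 < m by rewrite divr_gt0 ?exprn_gt0// mulr_gt0.
exists (4 * m)^-1; first by rewrite invr_gt0 mulr_gt0.
move=> X Y X1 Y1 XS eX eY [u [v YE]].
have [u' [v' [uv' le_uv]]] := hK u v.
have [[S0 _ _] Sa Sb] := SG.
have Sw0 i j : 0 < S i j \/ S i j = 0 /\ X i j = 0.
  have := S0 i j; rewrite le_eqVlt => /predU1P[S0'|]; last by left.
  right; split=> //; apply/eqP; rewrite eq_le; have [[-> _ _] _] := X1.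
  by rewrite leNgt XS -S0' ltxx.
rewrite (@log_likelihood_diff S X Y u v)//; last by move=> i j; rewrite XS.
under eq_bigr do rewrite -Sa.
under [X in _ + X <= _]eq_bigr do rewrite -Sb.
rewrite -scaling_marginals.
have pt i j : S i j * (u i + v j) <=
    (S i j - X i j) * (u' i + v' j) + (Y i j - X i j) -
    e ^+ 2 / 4 * (if 0 < S i j then (u i + v j) ^+ 2 else 0).
  have [Sij|[Sij Xij]] := Sw0 i j; last first.
    by rewrite YE Sij Xij ltxx; lra.
  rewrite Sij uv'//.
  have xe := eX i j Sij; have ye := eY i j Sij.
  have x0 : 0 < X i j by lra. have y0 : 0 < Y i j by lra.
  have x1 := Gamma1_le1 i j X1; have y1 := Gamma1_le1 i j Y1.
  have wE : u i + v j = ln (Y i j) - ln (X i j).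
    by rewrite YE lnM ?posrE ?expR_gt0// expRK; ring.
  have := @kl_term_ge R (X i j) (Y i j); rewrite (ltW x0) x1 y0 y1 => /(_ isT isT).
  have -> : ln (X i j / Y i j) = - (u i + v j) by rewrite wE ln_div ?posrE//; ring.
  have := dist_ln_le e0 ye xe; rewrite -wE ler_pdivlMr// => h.
  have : (u i + v j) ^+ 2 * e ^+ 2 <= (X i j - Y i j) ^+ 2.
    rewrite -(sqrrN (X i j - Y i j)) opprB -exprMn -real_normK ?num_real//.
    rewrite -[leRHS]real_normK ?num_real// lerXn2r ?nnegrE// normrM.
    by rewrite (gtr0_norm e0).
  lra.
apply: (le_trans (ler_sum _ (fun i _ => ler_sum _ (fun j _ => pt i j)))).
under eq_bigr do rewrite sumrB big_split/= -mulr_sumr sumrB.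
rewrite sumrB big_split/= -mulr_sumr sumrB.
have -> : \sum_i \sum_j X i j = 1 by case: X1.
have -> : \sum_i \sum_j Y i j = 1 by case: Y1.
have -> : \sum_i \sum_j (S i j - X i j) * (u' i + v' j) =
   \sum_i (a 0 i - row_sum X i) * u' i + \sum_j (b 0 j - col_sum X j) * v' j.
  have := scaling_marginals (S - X) u' v'.
  under eq_bigr do under eq_bigr do rewrite !mxE.
  move=> ->; congr (_ + _); apply: eq_bigr => k _; congr (_ * _).
    by rewrite -Sa /row_sum -sumrB; apply: eq_bigr => ? _; rewrite !mxE.
  by rewrite -Sb /col_sum -sumrB; apply: eq_bigr => ? _; rewrite !mxE.
have young k (g x : 'I_k -> R) : \sum_i g i * x i <=
    (4 * m)^-1 * (\sum_i g i ^+ 2) + m * \sum_i x i ^+ 2.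
  rewrite !mulr_sumr -big_split; apply: ler_sum => i _ /=.
  have : 0 <= (4 * m)^-1 * (g i - 2 * m * x i) ^+ 2.
    by rewrite mulr_ge0 ?sqr_ge0// invr_ge0; lra.
  have -> : (4 * m)^-1 * (g i - 2 * m * x i) ^+ 2 =
     (4 * m)^-1 * g i ^+ 2 + m * x i ^+ 2 - g i * x i by field; lra.
  lra.
have hu := young _ (fun i => a 0 i - row_sum X i) u'.
have hv := young _ (fun j => b 0 j - col_sum X j) v'.
rewrite /marginal_gap mulrDr.
have : m * (\sum_i u' i ^+ 2 + \sum_j v' j ^+ 2) <=
   e ^+ 2 / 4 * \sum_i \sum_j (if 0 < S i j then (u i + v j) ^+ 2 else 0).
  apply: (le_trans (ler_wpM2l (ltW m0) le_uv)).
  by rewrite mulrA /m (_ : e ^+ 2 / (4 * K) * K = e ^+ 2 / 4)//; field; lra.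
lra.
Qed.

End LogLikelihood.

(** * Geometric convergence of the procedure *)

Section Convergence.
Context {R : realType} {p q : nat} (a : 'rV[R]_p) (b : 'rV[R]_q).
Context (a_gt0 : forall i, 0 < a 0 i) (b_gt0 : forall j, 0 < b 0 j).
Context (a_sum : \sum_i a 0 i = 1) (b_sum : \sum_j b 0 j = 1).
Context (X0 S : 'M[R]_(p, q)).
Context (hX0 : Gamma1 X0) (SG : Gamma a b S) (SX : Supp S = Supp X0).

Local Arguments ipfp : simpl never.
Local Notation Y n := (ipfp a b X0 n.+1).

Let Y_Gamma1 n : Gamma1 (Y n).
Proof. by case: (ipfp_scaling_Gamma1 a_gt0 b_gt0 a_sum b_sum n.+1 hX0). Qed.

Let X0_Y n : scaling X0 (Y n).
Proof. by case: (ipfp_scaling_Gamma1 a_gt0 b_gt0 a_sum b_sum n.+1 hX0). Qed.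

Let X0_gt0 i j : (0 < X0 i j) = (0 < S i j).
Proof. by have /setP/(_ (i, j)) := SX; rewrite !inE. Qed.

Let Y_gt0 n i j : (0 < Y n i j) = (0 < S i j).
Proof. by rewrite (scaling_gt0 _ _ (X0_Y n)). Qed.

Let Y_step n i j :
  Y n.+1 i j = Y n i j / (row_ratio a (Y n) i * col_ratio b (Y n) j).
Proof. exact: ipfp_two_sided_step. Qed.

Lemma ipfp_gain n : marginal_gap a b (Y n) / 4 <=
  log_likelihood S (Y n.+1) - log_likelihood S (Y n).
Proof. by apply: log_likelihood_gain => // i j; rewrite (Y_gt0 n). Qed.

Lemma log_likelihood_nondecreasing :
  nondecreasing_seq (fun n => log_likelihood S (Y n)).
Proof.
apply/nondecreasing_seqP => n; rewrite -subr_ge0.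
by apply: le_trans (ipfp_gain n); rewrite divr_ge0// marginal_gap_ge0.
Qed.

(** Every term of the log-likelihood is nonpositive, so each of them is at least the
    whole sum, which never falls below its initial value. *)
Lemma ipfp_lower_bound :
  exists2 e : R, 0 < e & forall n i j, 0 < S i j -> e <= Y n i j.
Proof.
have S0 : Gamma0 S by case: SG.
have [Sge0 _ _] := S0.
pose P0 := log_likelihood S (Y 0).
have P0le0 : P0 <= 0 by exact: log_likelihood_le0.
pose T := \sum_i \sum_j (S i j)^-1.
exists (expR (P0 * T)) => [|n i j Sij]; first exact: expR_gt0.
rewrite -[leRHS]lnK ?posrE ?Y_gt0// ler_expR.
apply: (@le_trans _ _ (P0 / S i j)).
  rewrite ler_wnM2l// /T (bigD1 i)//= (bigD1 j)//= -addrA lerDl addr_ge0//.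
    by apply: sumr_ge0 => ? _; rewrite invr_ge0.
  by do 2!apply: sumr_ge0 => ? _; rewrite invr_ge0.
rewrite ler_pdivrMr// mulrC.
apply: (le_trans (log_likelihood_nondecreasing (leq0n n))).
have term k l : S k l * ln (Y n k l) <= 0.
  by rewrite mulr_ge0_le0// ln_le0// Gamma1_le1.
rewrite /log_likelihood (bigD1 i)//= (bigD1 j)//= -addrA gerDl -oppr_ge0 opprD.
by rewrite addr_ge0// oppr_ge0; do ?apply: sumr_le0 => ? _.
Qed.

(** The log-likelihood is self-bounding, with ratio [4 * C], and its increments
    dominate the marginal gap. *)
Lemma marginal_gap_geometric :
  exists K r, [/\ 0 <= K, 0 < r < 1 & forall n, marginal_gap a b (Y n) <= K * r ^+ n].
Proof.
have [e e0 Ye] := ipfp_lower_bound.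
have [C C0 hC] := log_likelihood_error_bound SG e0.
have [||n m nm|K [r [K0 r01 hK]]] := @geometric_of_self_bounding R
    (fun n => log_likelihood S (Y n)) (C * 4).
- exact: log_likelihood_nondecreasing.
- by exists 0 => n; apply: log_likelihood_le0 => //; case: SG.
- have YY : scaling (Y n) (Y m) := scaling_trans (scaling_sym (X0_Y n)) (X0_Y m).
  apply: (le_trans (hC _ _ (Y_Gamma1 n) (Y_Gamma1 m) (Y_gt0 n) (Ye n) (Ye m) YY)).
  by rewrite -mulrA ler_pM2l//; have := ipfp_gain n; lra.
exists (4 * K), r; split=> [|//|n]; first by rewrite mulr_ge0.
by have := hK n; have := ipfp_gain n; rewrite -mulrA; lra.
Qed.

Lemma marginals_geometric : exists2 t : R, 0 < t < 1 &
  (forall i, geometric_to t (fun n => row_sum (Y n) i) (a 0 i)) /\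
  (forall j, geometric_to t (fun n => col_sum (Y n) j) (b 0 j)).
Proof.
have [K [r [K0 /andP[r0 r1] hK]]] := marginal_gap_geometric.
exists (Num.sqrt r).
  by rewrite sqrtr_gt0 r0/= -sqrtr1 ltr_sqrt.
have root n x y : (y - x) ^+ 2 <= marginal_gap a b (Y n) ->
    `|x - y| <= Num.sqrt K * Num.sqrt r ^+ n.
  move=> h; rewrite distrC -sqrtr_sqr.
  have -> : Num.sqrt K * Num.sqrt r ^+ n = Num.sqrt (K * r ^+ n).
    rewrite sqrtrM//; congr (_ * _).
    by elim: n {h} => [|n ih]; rewrite ?expr0 ?sqrtr1// !exprS ih sqrtrM// ltW.
  rewrite ler_sqrt; first exact: le_trans h (hK n).
  by rewrite mulr_ge0// exprn_ge0// ltW.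
have sq0 k (f : 'I_k -> R) (P : pred 'I_k) : 0 <= \sum_(i | P i) f i ^+ 2.
  by apply: sumr_ge0 => ? _; exact: sqr_ge0.
split=> [i|j]; exists (Num.sqrt K) => n; apply: root; rewrite /marginal_gap.
  by rewrite (bigD1 i)//= -addrA lerDl; apply: addr_ge0; exact: sq0.
by rewrite [X in _ <= _ + X](bigD1 j)//= addrCA lerDl; apply: addr_ge0; exact: sq0.
Qed.

(** Passing to the limit in the logarithms of the accumulated scaling factors, rather
    than in the entries, shows that the limit is again a scaling of [X0]: no
    factor degenerates to 0 or infinity. *)
Lemma ipfp_geometric_limit : exists (t : R) (Xoo : 'M[R]_(p, q)),
  [/\ 0 < t < 1,
      (forall i, geometric_to t (fun n => row_sum (Y n) i) (a 0 i)),
      (forall j, geometric_to t (fun n => col_sum (Y n) j) (b 0 j)),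
      (forall i j, geometric_to t (fun n => Y n i j) (Xoo i j)) &
      scaling X0 Xoo].
Proof.
have [t t01 [hr hc]] := marginals_geometric.
have [e e0 Ye] := ipfp_lower_bound.
have Yge0 n i j : 0 <= Y n i j by have [[-> ]] := Y_Gamma1 n.
have row_ge n i : e <= row_sum (Y n) i.
  have [[Sge0 Sr _] _ _] := SG.
  have [j Sij] : exists j, 0 < S i j.
    apply/existsP; have := Sr i; apply: contraTT => /existsPn h.
    by rewrite -leNgt; apply: sumr_le0 => j _; rewrite leNgt.
  apply: (le_trans (Ye n i j Sij)); rewrite /row_sum (bigD1 j)//= lerDl.
  exact: sumr_ge0.
have col_ge n j : e <= col_sum (Y n) j.
  have [[Sge0 _ Sc] _ _] := SG.
  have [i Sij] : exists i, 0 < S i j.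
    apply/existsP; have := Sc j; apply: contraTT => /existsPn h.
    by rewrite -leNgt; apply: sumr_le0 => i _; rewrite leNgt.
  apply: (le_trans (Ye n i j Sij)); rewrite /col_sum (bigD1 i)//= lerDl.
  exact: sumr_ge0.
have log_limit (c : R) (r : nat -> R) : 0 < c -> (forall n, e <= r n) ->
    geometric_to t r c -> exists l : R, geometric_to t
      (fun n => - \sum_(k < n) ln (r k / c)) l.
  move=> c0 er [K hK].
  have d0 : 0 < Num.min e c by rewrite lt_min e0.
  apply: (@geometric_cauchy R t t01 _ (K / Num.min e c)) => n.
  rewrite big_ord_recr/= opprD addrAC subrr add0r normrN.
  have rn0 : 0 < r n by exact: lt_le_trans (er n).
  rewrite ln_div ?posrE//.
  have de : Num.min e c <= r n by rewrite ge_min er.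
  have dc : Num.min e c <= c by rewrite ge_min lexx orbT.
  apply: (le_trans (dist_ln_le d0 de dc)).
  by rewrite mulrAC ler_pM2r ?invr_gt0.
have /choice[u hu] : forall i, exists l : R, geometric_to t
    (fun n => - \sum_(k < n) ln (row_ratio a (Y k) i)) l.
  by move=> i; exact: (log_limit (a 0 i) (fun k => row_sum (Y k) i)).
have /choice[v hv] : forall j, exists l : R, geometric_to t
    (fun n => - \sum_(k < n) ln (col_ratio b (Y k) j)) l.
  by move=> j; exact: (log_limit (b 0 j) (fun k => col_sum (Y k) j)).
pose Xoo := \matrix_(i, j) (Y 0 i j * expR (u i + v j)).
have YE n i j : Y n i j = Y 0 i j *
    expR (- \sum_(k < n) ln (row_ratio a (Y k) i) +
          - \sum_(k < n) ln (col_ratio b (Y k) j)).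
  elim: n => [|n ih]; first by rewrite !big_ord0 oppr0 addr0 expR0 mulr1.
  have [Y0 _] := Y_Gamma1 n.
  rewrite Y_step ih -mulrA !big_ord_recr/= -/(ipfp a b X0 n.+1).
  rewrite -[row_ratio _ _ _ in X in _ * (_ * X)]lnK ?posrE ?row_ratio_gt0//.
  rewrite -[col_ratio _ _ _ in X in _ * (_ * X)]lnK ?posrE ?col_ratio_gt0//.
  rewrite -expRD -expRN -expRD; congr (_ * expR _).
  ring.
exists t, Xoo; split=> // [i j|]; last first.
  apply: scaling_trans (X0_Y 0) _; exists u, v => i j; by rewrite mxE.
have [Sij|Sij] := ltP 0 (S i j); last first.
  have Y00 n : Y n i j = 0.
    by apply/eqP; rewrite eq_le Yge0 leNgt Y_gt0 -leNgt Sij.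
  have -> : Xoo i j = 0 by rewrite mxE Y00 mul0r.
  by exists 0 => n; rewrite Y00 subrr normr0 mul0r.
have Y0ij : 0 < Y 0 i j by rewrite Y_gt0.
have lnY n : ln (Y n i j) = ln (Y 0 i j) +
    (- \sum_(k < n) ln (row_ratio a (Y k) i) +
     - \sum_(k < n) ln (col_ratio b (Y k) j)).
  by rewrite YE lnM ?posrE ?expR_gt0// expRK.
have cvg_ln : geometric_to t (fun n => ln (Y n i j)) (ln (Y 0 i j) + (u i + v j)).
  under eq_fun do rewrite lnY.
  apply: geometric_toD; first exact: geometric_to_cst.
  exact: geometric_toD.
have ln_le n : ln (Y n i j) <= 0 by rewrite ln_le0// Gamma1_le1.
have lim_le := geometric_to_ub t01 cvg_ln ln_le.
apply: (@geometric_to_le R t _ _ _ _ 1 cvg_ln) => n; rewrite mul1r.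
have -> : Xoo i j = expR (ln (Y 0 i j) + (u i + v j)).
  by rewrite mxE [RHS]expRD lnK ?posrE.
rewrite -{1}[Y n i j]lnK ?posrE ?Y_gt0//.
exact: dist_expR_le.
Qed.

End Convergence.

(** * Relative entropy *)

Section Entropy.
Context {R : realType} {p q : nat} (a : 'rV[R]_p) (b : 'rV[R]_q).
Context (a_sum : \sum_i a 0 i = 1).
Implicit Types (X Y Z : 'M[R]_(p, q)).

Definition sq_dist X Y := \sum_i \sum_j (X i j - Y i j) ^+ 2.

Lemma sq_dist_le0 X Y : sq_dist X Y <= 0 -> X = Y.
Proof.
move=> h; have row0 i : 0 <= \sum_j (X i j - Y i j) ^+ 2.
  by apply: sumr_ge0 => j _; exact: sqr_ge0.
have /eqP d0 : sq_dist X Y == 0 by rewrite eq_le h sumr_ge0.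
apply/matrixP => i j.
have ri := psumr_eq0P (fun i _ => row0 i) d0 (i := i) isT.
have := psumr_eq0P (fun k _ => sqr_ge0 (X i k - Y i k)) ri (i := j) isT.
by move=> /eqP; rewrite sqrf_eq0 subr_eq0 => /eqP.
Qed.

Lemma rel_entropy_sum X Z : Gamma1 Z -> Supp Z \subset Supp X ->
  rel_entropy Z X = (\sum_i \sum_j Z i j * ln (Z i j / X i j))%:E.
Proof.
move=> [[Z0 _ _] _] ZX; rewrite /rel_entropy ZX pair_bigA /=.
congr (_%:E); rewrite big_mkcond; apply: eq_bigr => -[i j] _ /=.
case: ifPn => // ij; suff -> : Z i j = 0 by rewrite mul0r.
apply/eqP; rewrite eq_le Z0 andbT leNgt; apply: contra ij => Zij.
by apply: (fintype.subsetP ZX); rewrite inE.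
Qed.

(** On the support of [Z], [ln (Z / X) = ln (Z / Y) + u i + v j], and the sum of
    [Z * (u + v)] is the same for [Z] and [Y] since their marginals agree. *)
Lemma entropy_gap X Y Z : Gamma a b Y -> scaling X Y -> Gamma_sub a b X Z ->
  \sum_i \sum_j Y i j * ln (Y i j / X i j) + sq_dist Z Y / 4 <=
  \sum_i \sum_j Z i j * ln (Z i j / X i j).
Proof.
move=> YG [u [v YE]] [ZG ZX].
have Y1 := Gamma_Gamma1 a_sum YG; have Z1 := Gamma_Gamma1 a_sum ZG.
have [[Y0 _ _] Ya Yb] := YG; have [[Z0 _ _] Za Zb] := ZG.
have XY : scaling X Y by exists u, v.
have -> : \sum_i \sum_j Y i j * ln (Y i j / X i j) =
    \sum_i \sum_j Z i j * (u i + v j).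
  transitivity (\sum_i \sum_j Y i j * (u i + v j)).
    apply: eq_bigr => i _; apply: eq_bigr => j _.
    have := Y0 i j; rewrite le_eqVlt => /predU1P[<-|Yij]; first by rewrite !mul0r.
    have Xij : 0 < X i j by rewrite -(scaling_gt0 i j XY).
    congr (_ * _); rewrite YE mulrAC divff ?gt_eqF// mul1r expRK//.
  rewrite !scaling_marginals; congr (_ + _); apply: eq_bigr => k _.
    by rewrite Ya Za.
  by rewrite Yb Zb.
(* both total masses are 1: adding their difference changes nothing and makes
   each summand nonnegative *)
have -> : \sum_i \sum_j Z i j * ln (Z i j / X i j) =
    \sum_i \sum_j (Z i j * ln (Z i j / X i j) - Z i j + Y i j).
  under [RHS]eq_bigr do rewrite big_split/= sumrB.
  rewrite big_split/= sumrB.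
  have -> : \sum_i \sum_j Z i j = 1 by case: Z1.
  have -> : \sum_i \sum_j Y i j = 1 by case: Y1.
  by rewrite subrK.
rewrite /sq_dist mulr_suml -big_split; apply: ler_sum => i _ /=.
rewrite mulr_suml -big_split; apply: ler_sum => j _ /=.
have := Z0 i j; rewrite le_eqVlt => /predU1P[Zij|Zij].
  rewrite -Zij !mul0r !sub0r !add0r sqrrN oppr0 add0r.
  have y0 := Y0 i j; have y1 := Gamma1_le1 i j Y1.
  have : Y i j * Y i j <= Y i j * 1 by rewrite ler_wpM2l.
  by rewrite expr2; lra.
have Xij : 0 < X i j.
  by have := fintype.subsetP ZX (i, j); rewrite !inE => /(_ Zij).
have Yij : 0 < Y i j by rewrite (scaling_gt0 i j XY).
have := @kl_term_ge R (Z i j) (Y i j).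
rewrite (ltW Zij) Yij !Gamma1_le1// => /(_ isT isT).
have -> : ln (Z i j / X i j) = ln (Z i j / Y i j) + (u i + v j).
  rewrite YE !ln_div ?posrE ?mulr_gt0 ?expR_gt0//.
  by rewrite lnM ?posrE ?expR_gt0// expRK; ring.
lra.
Qed.

End Entropy.

Unset Implicit Arguments.
Set Strict Implicit.

Theorem theorem2 (R : realType) (p q : nat) (hp : (2 <= p)%N) (hq : (2 <= q)%N)
  (a : 'rV[R]_p) (b : 'rV[R]_q)
  (a_gt0 : forall i, 0 < a 0 i) (b_gt0 : forall j, 0 < b 0 j)
  (a_sum : \sum_i a 0 i = 1) (b_sum : \sum_j b 0 j = 1)
  (X0 : 'M[R]_(p, q)) (hX0 : Gamma1 X0)
  (hsupp : exists2 S, Gamma a b S & Supp S = Supp X0) :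
  ((forall i, geometric_cvg
                (fun n => row_ratio a (ipfp a b X0 (2 * n)%N) i) 1) /\
   (forall j, geometric_cvg
                (fun n => col_ratio b (ipfp a b X0 (2 * n + 1)%N) j) 1)) /\
  exists Xoo : 'M[R]_(p, q),
    [/\ geometric_cvg (ipfp a b X0) Xoo,
        Supp Xoo = Supp X0,
        Gamma a b `&` diag_equiv X0 = [set Xoo]
      & [set Y : 'M[R]_(p, q) | Gamma_sub a b X0 Y /\
           forall Z, Gamma_sub a b X0 Z ->
             (rel_entropy Y X0 <= rel_entropy Z X0)%E] = [set Xoo]].
Proof.
have [S SG SX] := hsupp.
have [t [Xoo [t01 hrow hcol hent X0Xoo]]] :=
  ipfp_geometric_limit a_gt0 b_gt0 a_sum b_sum hX0 SG SX.
have /andP[t0 t1] := t01.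
have ratio_cvg (c : R) (x : nat -> R) (f : nat -> nat) : 0 < c ->
    geometric_to t (fun n => x n.+1) c -> (forall n, n <= f n)%N ->
    geometric_cvg (fun n => x (f n) / c : R^o) 1.
  move=> c0 [K hK] nf.
  apply: (@geometric_cvg_of_le R R^o _ 1 (K / c / t) t t01) => n n0.
  have fn0 : (0 < f n)%N by exact: leq_trans (nf n).
  have -> : x (f n) / c - 1 = (x (f n) - c) / c by rewrite mulrBl divff ?gt_eqF.
  have K0 : 0 <= K by have := le_trans (normr_ge0 _) (hK 0%N); rewrite expr0 mulr1.
  rewrite normrM (ger0_norm (_ : 0 <= c^-1)) ?invr_ge0 ?(ltW c0)//.
  have -> : K / c / t * t ^+ n = K * t ^+ n.-1 / c.
    by rewrite -{1}(prednK n0) exprS; field; rewrite !gt_eqF.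
  rewrite ler_pM2r ?invr_gt0//.
  have := hK (f n).-1; rewrite prednK// => /le_trans; apply.
  rewrite ler_wpM2l// ler_wiXn2l ?(ltW t0) ?(ltW t1)//.
  by rewrite -ltnS !prednK// nf.
split.
  split=> [i|j].
    apply: (ratio_cvg _ (fun n => row_sum (ipfp a b X0 n) i)) => // n.
    by rewrite mul2n -addnn leq_addr.
  apply: (ratio_cvg _ (fun n => col_sum (ipfp a b X0 n) j)) => // n.
  by rewrite mul2n -addnn -addnA leq_addr.
have XooG0 : Gamma0 Xoo by case: hX0 => X0G0 _; exact: scaling_Gamma0 X0Xoo X0G0.
have XooG : Gamma a b Xoo.
  split=> // [i|j].
    by apply: (geometric_to_unique t01 (geometric_to_sum (hent i)) (hrow i)).
  apply: (geometric_to_unique t01 _ (hcol j)).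
  exact: geometric_to_sum (fun i => hent i j).
have XooS : Supp Xoo = Supp X0 := scaling_Supp X0Xoo.
have sub_of Y : Gamma a b Y -> scaling X0 Y -> Gamma_sub a b X0 Y.
  by move=> YG XY; split=> //; rewrite (scaling_Supp XY).
have XooGs := sub_of _ XooG X0Xoo.
exists Xoo; split=> //.
- have [K hK] : geometric_to t
      (fun n => \sum_i \sum_j `|ipfp a b X0 n.+1 i j - Xoo i j|) 0.
    have habs i j : geometric_to t (fun n => `|ipfp a b X0 n.+1 i j - Xoo i j|) 0.
      apply: (@geometric_to_le R t _ _ _ _ 1 (hent i j)) => n.
      by rewrite subr0 normr_id mul1r.
    have := geometric_to_sum (fun i => geometric_to_sum (habs i)).
    by rewrite [X in geometric_to _ _ X]big1// => i _; rewrite big1.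
  apply: (@geometric_cvg_of_le R _ _ _ (K / t) t t01) => -[//|n] _.
  rewrite exprS mulrA divfK ?gt_eqF//.
  apply: le_trans (hK n); rewrite subr0.
  have s0 : 0 <= \sum_i \sum_j `|ipfp a b X0 n.+1 i j - Xoo i j|.
    by do 2!apply: sumr_ge0 => ? _.
  rewrite (ger0_norm s0) [leLHS]/Num.norm /= mx_normrE.
  apply: bigmax_le => // -[i j] _ /=.
  rewrite !mxE (bigD1 i)//= (bigD1 j)//= -addrA lerDl addr_ge0//.
    by apply: sumr_ge0.
  by do 2!apply: sumr_ge0 => ? _.
- apply/seteqP; split=> [Y /= [YG /diag_equivP XY]|Y ->]; last first.
    by split=> //; exact/diag_equivP.
  have h1 := entropy_gap a_sum YG XY XooGs.
  have h2 := entropy_gap a_sum XooG X0Xoo (sub_of _ YG XY).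
  have h3 : 0 <= sq_dist Xoo Y.
    by do 2!apply: sumr_ge0 => ? _; exact: sqr_ge0.
  by apply: sq_dist_le0; lra.
have entE Z : Gamma_sub a b X0 Z ->
    rel_entropy Z X0 = (\sum_i \sum_j Z i j * ln (Z i j / X0 i j))%:E.
  by move=> [ZG ZX]; apply: rel_entropy_sum => //; exact: Gamma_Gamma1 ZG.
apply/seteqP; split=> [Y /= [YG Ymin]|Y ->].
  have := Ymin _ XooGs; rewrite !entE// lee_fin => h.
  by apply: sq_dist_le0; have := entropy_gap a_sum XooG X0Xoo YG; lra.
split=> // Z ZG; rewrite !entE// lee_fin.
apply: le_trans (entropy_gap a_sum XooG X0Xoo ZG); rewrite lerDl divr_ge0//.
by do 2!apply: sumr_ge0 => ? _; exact: sqr_ge0.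
Qed.
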